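(* Let $\epsilon>0$ and $p\in(0,1)$ be fixed, and let $r\ge 3$. Then $$\frac{H_r(n,p,\epsilon)}{E(n,p)}\ge 2^{\Omega(n^{\gamma})},$$ where $\gamma=\frac12-o_n(1)$ if $r\ge 4$ and $\gamma=\frac13-o_n(1)$ if $r=3$ (here $n\to\infty$ over those $n$ for which $p\binom{n}{r}$ is an integer).
   Context: An $r$-graph $G$ has a vertex set $V(G)$ and an edge set consisting of $r$-element subsets of $V(G)$. An $n$-vertex $r$-graph has density $p$ if it has exactly $p\binom{n}{r}$ edges. A Hamiltonian cycle of an $n$-vertex $r$-graph $G$ is given by an ordering $v_1,\dots,v_n$ of its vertices such that for every $i$ the set $\{v_i,\dots,v_{i+r-1}\}$ (indices modulo $n$) is an edge; the cycle is identified with this set of $n$ edges. $H(G)$ is the number of Hamiltonian cycles of $G$. For $\epsilon>0$, an $n$-vertex $r$-graph $G$ is $(\epsilon,p)$-quasi random if its density is $p$ and for every $W\subset V(G)$ with $|W|=\lfloor n/2\rfloor$, the induced $r$-graph $G[W]$ has density (number of edges divided by $\binom{|W|}{r}$) in $(p-\epsilon,p+\epsilon)$. $H_r(n,p,\epsilon)$ is the maximum of $H(G)$ over all $n$-vertex $(\epsilon,p)$-quasi random $r$-graphs $G$. $E(n,p)=p^n(n-1)!/2$. *)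

(* Defs.v *)
From Stdlib Require Import Reals.
From mathcomp Require Import all_boot all_fingroup.
From mathcomp Require Import boolp.

Set Implicit Arguments.
Unset Strict Implicit.
Unset Printing Implicit Defensive.

Definition is_rgraph (n r : nat) (G : {set {set 'I_n}}) : bool :=
  [forall e in G, #|e| == r].

Definition induced_edges (n : nat) (G : {set {set 'I_n}}) (W : {set 'I_n}) : nat :=
  #|[set e in G | e \subset W]|.

Definition quasi_random (n r : nat) (eps p : R) (G : {set {set 'I_n}}) : Prop :=
  is_rgraph r G /\
  INR #|G| = Rmult p (INR 'C(n, r)) /\
  (forall W : {set 'I_n}, #|W| = n./2 ->
     Rlt (p - eps) (INR (induced_edges G W) / INR 'C(#|W|, r)) /\
     Rlt (INR (induced_edges G W) / INR 'C(#|W|, r)) (p + eps)).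

(* The ordering v_1,...,v_n is given by a permutation s : position |-> vertex.
   The i-th edge of the cycle is {v_i, ..., v_{i+r-1}} (positions mod n):
   a vertex v lies in it iff its position s^-1 v is (i + j) mod n, j < r. *)
Definition cyc_edge (n r : nat) (s : {perm 'I_n}) (i : 'I_n) : {set 'I_n} :=
  [set v : 'I_n | [exists j : 'I_r, val ((s^-1)%g v) == (i + j) %% n]].

Definition ham_cycle (n r : nat) (s : {perm 'I_n}) : {set {set 'I_n}} :=
  [set cyc_edge r s i | i : 'I_n].

Definition Hcount (n r : nat) (G : {set {set 'I_n}}) : nat :=
  #|[set ham_cycle r s | s : {perm 'I_n} & ham_cycle r s \subset G]|.

(* H_r(n,p,eps): maximum of H(G) over (eps,p)-quasi random n-vertex r-graphs
   (0 if there is none). *)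
Definition Hmax (r n : nat) (p eps : R) : nat :=
  \max_(G : {set {set 'I_n}} | `[< quasi_random r eps p G >]) Hcount r G.

Definition Eexp (n : nat) (p : R) : R := Rdiv (Rmult (pow p n) (INR (n.-1)`!)) 2.

(* Main.v *)
Require Import Defs.
From Stdlib Require Import Reals.
From mathcomp Require Import all_boot all_fingroup.
From Stdlib Require Lra.
From mathcomp Require Import order ssralg ssrnum archimedean reals.
From mathcomp Require Import sequences exp.
From mathcomp Require Import zify ring lra.

(* Attach independent fair signs y_S to the (r-1)-subsets S of the vertex set and
   give every r-set e the weight w_e = 1 + d * sum_{v in e} y_{e \ v} with d small.
   Consecutive edges of a tight cycle share an (r-1)-set, whose sign squared gives a
   positive correlation, and all Fourier coefficients of prod_e w_e are nonnegative;
   hence over the edges of any tight cycle E prod w_e >= (1 + d^2)^(n/2).  There are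
   at least of order n^2 signs, so by Chernoff the average weight is 1 + o(1) up to a
   failure probability smaller than any C^-n.  Some choice of signs thus has average
   weight close to 1 and, averaged over vertex orderings, prod w_e exponentially large.
   The random r-graph containing e with probability p (1 - th) w_e, independently,
   is then quasi-random, again by Chernoff and a union bound over the 2^n vertex sets,
   and keeps an exponential gain over p^n; the density is made exactly p by adding
   few edges, which does not destroy cycles.  The gain is 2^(Omega(n)), so constant
   exponents gamma <= 1 suffice. *)

(** * Random subsets with independent inclusions, and a Chernoff bound *)

Section RandomSubset.
Import Order.TTheory GRing.Theory Num.Theory.
Local Open Scope ring_scope.
Context {R : realType} {T : finType}.
Implicit Types (pi : T -> R) (f g : {set T} -> R) (B J : {set T}).

Definition subset_weight pi J : R := \prod_i (if i \in J then pi i else 1 - pi i).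

(* Expectation of [f J] when each [i] lies in the random set [J] independently
   with probability [pi i]. *)
Definition expect pi f : R := \sum_(J : {set T}) subset_weight pi J * f J.

Lemma eq_expect pi {f} g : f =1 g -> expect pi f = expect pi g.
Proof. by move=> fg; apply: eq_bigr => J _; rewrite fg. Qed.

Lemma expect_prod pi (g : T -> bool -> R) :
  expect pi (fun J => \prod_i g i (i \in J)) =
  \prod_i (pi i * g i true + (1 - pi i) * g i false).
Proof.
rewrite bigA_distr; apply: eq_bigr => J _; rewrite -big_split /=.
by apply: eq_bigr => i _; case: (i \in J).
Qed.

Lemma expect1 pi : expect pi (fun=> 1) = 1.
Proof.
have := expect_prod pi (fun _ _ => 1); rewrite (@eq_expect _ _ (fun=> 1)).
  by move=> ->; apply: big1 => i _; ring.
by move=> J; rewrite big1.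
Qed.

Lemma expectD pi f g : expect pi (fun J => f J + g J) = expect pi f + expect pi g.
Proof. by rewrite -big_split; apply: eq_bigr => J _; rewrite mulrDr. Qed.

Lemma expectZ pi c f : expect pi (fun J => c * f J) = c * expect pi f.
Proof. by rewrite big_distrr; apply: eq_bigr => J _; rewrite /= mulrCA. Qed.

Lemma expect_sum pi (I : Type) (s : seq I) (P : pred I) (F : I -> {set T} -> R) :
  expect pi (fun J => \sum_(i <- s | P i) F i J) =
  \sum_(i <- s | P i) expect pi (F i).
Proof.
by rewrite exchange_big; apply: eq_bigr => J _; rewrite big_distrr.
Qed.

Lemma expect_supset pi B :
  expect pi (fun J => (B \subset J)%:R) = \prod_(i in B) pi i.
Proof.
rewrite (big_mkcond (mem B)) /=.
pose h i b : R := if i \in B then b%:R else 1.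
rewrite (@eq_expect _ _ (fun J => \prod_i h i (i \in J))).
  by rewrite (expect_prod pi h); apply: eq_bigr => i _; rewrite /h; case: ifP => _ /=; ring.
move=> J; rewrite /h -big_mkcond /=; case: (boolP (B \subset J)) => [/subsetP BJ|].
  by rewrite big1 // => i /BJ ->.
by case/subsetPn => i iB iJ; rewrite (bigD1 i) //= (negbTE iJ) mul0r.
Qed.

Variable pi : T -> R.
Hypothesis pi01 : forall i, 0 <= pi i <= 1.

Lemma subset_weight_ge0 J : 0 <= subset_weight pi J.
Proof.
apply: prodr_ge0 => i _; have /andP[? ?] := pi01 i.
by case: ifP => // _; rewrite subr_ge0.
Qed.

Lemma le_expect f g : (forall J, f J <= g J) -> expect pi f <= expect pi g.
Proof.
by move=> fg; apply: ler_sum => J _; rewrite ler_wpM2l ?subset_weight_ge0.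
Qed.

(** If all [f J] were below [c], the nonnegative terms of [expect pi (fun J => c - f J)] could only
    sum to something nonpositive if every weight vanished, but the weights sum to 1. *)
Lemma expect_exists f c : c <= expect pi f -> exists J, c <= f J.
Proof.
move=> cf; case: (boolP [exists J, c <= f J]) => [/existsP //|].
rewrite negb_exists => /forallP /= fc.
have {}fc J : f J < c by rewrite ltNge fc.
have fb : expect pi f < c.
  rewrite -[ltRHS]mulr1 -(expect1 pi) -expectZ /expect -subr_gt0 -sumrB.
  have -> : \sum_(J : {set T}) (subset_weight pi J * (c * 1) - subset_weight pi J * f J) =
         expect pi (fun J => c - f J) by apply: eq_bigr => J _; ring.
  rewrite lt_def; apply/andP; split; last first.
    by apply: sumr_ge0 => J _; rewrite mulr_ge0 ?subset_weight_ge0 // subr_ge0 ltW.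
  apply/eqP => /psumr_eq0P E0.
  have W0 J : subset_weight pi J = 0.
    have := E0 _ J isT; move/(_ _)/eqP; rewrite mulf_eq0 subr_eq0 [c == _]eq_sym (lt_eqF (fc J)) orbF.
    by move=> H; apply/eqP/H => K _; rewrite mulr_ge0 ?subset_weight_ge0 // subr_ge0 ltW.
  have := expect1 pi; rewrite /expect big1; first by move/eqP; rewrite eq_sym oner_eq0.
  by move=> J _; rewrite W0 mul0r.
by move: (lt_le_trans fb cf); rewrite ltxx.
Qed.

(** Follows from [expR (- y) >= 1 - y] and [(1 + y + 2 y^2)(1 - y) = 1 + y^2 (1 - 2 y) >= 1]. *)
Lemma expR_le_quadratic (y : R) : `|y| <= 1 / 2 -> expR y <= 1 + y + 2 * y ^+ 2.
Proof.
rewrite ler_norml => /andP[y1 y2].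
have e1 := expR_ge1Dx (- y).
have e3 : expR y * expR (- y) = 1 by rewrite -expRD subrr expR0.
have e4 : 0 < 1 + y + 2 * y ^+ 2 by have := sqr_ge0 y; lra.
have e5 : 1 <= (1 + y + 2 * y ^+ 2) * (1 - y).
  have -> : (1 + y + 2 * y ^+ 2) * (1 - y) = 1 + y ^+ 2 * (1 - 2 * y) by ring.
  by rewrite lerDl mulr_ge0 ?sqr_ge0 //; lra.
rewrite -[leLHS]mulr1; apply: le_trans (ler_wpM2l (expR_ge0 _) e5) _.
rewrite mulrCA -[leRHS]mulr1 ler_pM2l // -[leRHS]e3.
by apply: ler_wpM2l; rewrite ?expR_ge0 //; lra.
Qed.

Definition deviation B J : R := #|J :&: B|%:R - \sum_(i in B) pi i.

(** Independence factors the expectation over [B]. In each factor the linear terms cancel because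
    the indicator is centred, so the quadratic bound leaves [1 + 2 y^2 q (1 - q)] with
    [q = pi i]. *)
Lemma expect_exp_deviation B (y : R) : `|y| <= 1 / 2 ->
  expect pi (fun J => expR (y * deviation B J)) <= expR (2 * y ^+ 2 * #|B|%:R).
Proof.
move=> y2; pose h i b : R := if i \in B then expR (y * (b%:R - pi i)) else 1.
rewrite (@eq_expect _ _ (fun J => \prod_i h i (i \in J))); last first.
  move=> J; rewrite /h -big_mkcond /= -expR_sum -big_distrr /= sumrB /deviation.
  have -> // : \sum_(i in B) (i \in J)%:R = #|J :&: B|%:R :> R.
  rewrite -sum1_card natr_sum (bigID (mem J)) /= [X in _ + X]big1 ?addr0; last first.
    by move=> i /andP[_ /negbTE->].
  by apply: eq_big => [i|i /andP[_ ->] //]; rewrite inE andbC.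
rewrite (expect_prod pi h) mulr_natr.
have -> : expR (2 * y ^+ 2 *+ #|B|) = \prod_(i in B) expR (2 * y ^+ 2).
  by rewrite -expR_sum sumr_const.
rewrite [leRHS]big_mkcond /=; apply: ler_prod => i _.
have /andP[p0 p1] := pi01 i; rewrite /h; case: ifP => _; last first.
  by apply/andP; split; lra.
apply/andP; split; first by rewrite addr_ge0 // mulr_ge0 ?expR_ge0 ?subr_ge0.
have ny (t : R) : `|t| <= 1 -> `|y * t| <= 1 / 2.
  by move=> t1; rewrite normrM -[leRHS]mulr1 ler_pM.
have A1 : `|1 - pi i| <= 1 by rewrite ler_norml; apply/andP; split; lra.
have A0 : `|0 - pi i| <= 1 by rewrite ler_norml; apply/andP; split; lra.
apply: le_trans (expR_ge1Dx _).
apply: (@le_trans _ _ (pi i * (1 + y * (1 - pi i) + 2 * (y * (1 - pi i)) ^+ 2)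
    + (1 - pi i) * (1 + y * (0 - pi i) + 2 * (y * (0 - pi i)) ^+ 2))).
  apply: lerD; apply: ler_wpM2l; rewrite ?subr_ge0 //; apply: expR_le_quadratic; exact: ny.
rewrite -subr_ge0.
set q := pi i in p0 p1 *.
have -> : 1 + 2 * y ^+ 2 - (q * (1 + y * (1 - q) + 2 * (y * (1 - q)) ^+ 2) +
   (1 - q) * (1 + y * (0 - q) + 2 * (y * (0 - q)) ^+ 2)) =
   2 * y ^+ 2 * (1 - q + q ^+ 2) by ring.
apply: mulr_ge0; first by rewrite mulr_ge0 ?sqr_ge0.
by rewrite addr_ge0 ?subr_ge0 ?sqr_ge0.
Qed.

(** Exponential Markov inequality with parameter [lam]: the threshold contributes
    [exp(-4 lam^2 |B|)], and the exponential moment gives back half of that exponent. Adding the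
    moments at [lam] and [- lam] handles both tails at once. *)
Lemma chernoff B (lam : R) : 0 < lam <= 1 / 2 ->
  expect pi (fun J => (4 * lam * #|B|%:R <= `|deviation B J|)%R%:R)
  <= 2 * expR (- (2 * lam ^+ 2 * #|B|%:R)).
Proof.
case/andP=> l0 l2; set b := #|B|%:R : R.
apply: (@le_trans _ _ (expect pi (fun J => expR (- (4 * lam ^+ 2 * b)) *
  (expR (lam * deviation B J) + expR (- lam * deviation B J))))).
  apply: le_expect => J; case: (boolP (4 * lam * b <= `|deviation B J|)) => [|_]; last first.
    by rewrite mulr0n mulr_ge0 ?addr_ge0 ?expR_ge0.
  rewrite mulr1n mulrDr -!expRD; set D := deviation B J => bD.
  have : 4 * lam ^+ 2 * b <= lam * `|D|.
    by rewrite expr2 mulrA mulrAC mulrC ler_pM2l.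
  have e0 x : 0 <= x -> 1 <= expR x :> R by move=> ?; rewrite -expR0 ler_expR.
  case: (ger0P D) => D0 H.
    have := e0 (- (4 * lam ^+ 2 * b) + lam * D) ltac:(lra).
    have := expR_ge0 (- (4 * lam ^+ 2 * b) + - lam * D); lra.
  have := e0 (- (4 * lam ^+ 2 * b) + - lam * D) ltac:(lra).
  have := expR_ge0 (- (4 * lam ^+ 2 * b) + lam * D); lra.
rewrite expectZ expectD.
have nl : `|lam| <= 1 / 2 by rewrite gtr0_norm.
have h1 := expect_exp_deviation B _ nl.
have h2 : expect pi (fun J => expR (- lam * deviation B J)) <= expR (2 * lam ^+ 2 * b).
  by rewrite -(sqrrN lam); apply: expect_exp_deviation; rewrite normrN.
have -> : - (2 * lam ^+ 2 * b) = - (4 * lam ^+ 2 * b) + 2 * lam ^+ 2 * b by ring.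
rewrite expRD; have := ler_wpM2l (expR_ge0 (- (4 * lam ^+ 2 * b))) (lerD h1 h2); lra.
Qed.

End RandomSubset.

(** * Combinatorics of tight Hamiltonian cycles *)

Section TightCycles.
Context {n r : nat}.
Implicit Types (s t : {perm 'I_n}) (i : 'I_n).

Lemma modn_wrap a : a < n.*2 -> a %% n = if a < n then a else a - n.
Proof.
move=> an; case: ifP => [|/negbT]; first exact: modn_small.
rewrite -leqNgt => na; rewrite -{1}(subnK na) modnDr modn_small //; lia.
Qed.

(** The last disjunct is the wrap-around, where position [x] is reached as [x + n]. *)
Lemma mem_cyc_edge s i x : r <= n ->
  (s x \in cyc_edge r s i) =
  ((i <= x < i + r) || (x + n < i + r)).
Proof.
move=> rn; rewrite inE permK /=; have xn := ltn_ord x; have ni := ltn_ord i.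
apply/existsP/idP => [[j /eqP ->]|H].
  have jr := ltn_ord j; rewrite modn_wrap; last by lia.
  case: ifP; lia.
case: (leqP i x) => ix.
  have jr : x - i < r by lia.
  by exists (Ordinal jr); rewrite /= modn_wrap; [case: ifP; lia|lia].
have jr : x + n - i < r by lia.
by exists (Ordinal jr); rewrite /= modn_wrap; [case: ifP; lia|lia].
Qed.

Lemma card_cyc_edge s i : r <= n -> #|cyc_edge r s i| = r.
Proof.
move=> rn; have n0 : 0 < n by case: i => m; lia.
pose f (j : 'I_r) := s (Ordinal (ltn_pmod (i + j) n0)).
have -> : cyc_edge r s i = [set f j | j : 'I_r].
  apply/setP => v; rewrite inE; apply/existsP/imsetP => [[j /eqP vj]|[j _ ->]].
    by exists j => //; apply: (perm_inj (s := s^-1%g)); rewrite permK; apply: val_inj.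
  by exists j; rewrite permK.
rewrite card_imset ?card_ord // => j k /perm_inj /(congr1 val) /=.
have jr := ltn_ord j; have kr := ltn_ord k; have ni := ltn_ord i.
rewrite !modn_wrap; try lia; move=> H; apply: val_inj => /=; move: H; do 2 case: ifP; lia.
Qed.

(** The witnesses are the first vertex of edge [i] and the last vertex of edge [i']; the position
    [i + r] of the latter may wrap around. *)
Lemma cyc_edge_shift s i i' : r < n -> 0 < r -> i' = i.+1 :> nat ->
  exists v v', [/\ v \in cyc_edge r s i, v' \in cyc_edge r s i' &
    cyc_edge r s i :\ v = cyc_edge r s i' :\ v'].
Proof.
move=> rn r0 ii'; have n0 : 0 < n by lia.
have ni' := ltn_ord i'.
pose w := Ordinal (ltn_pmod (i + r) n0).
have wE : w = (if i + r < n then i + r else i + r - n) :> nat by rewrite /= modn_wrap; lia.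
exists (s i), (s w); rewrite !mem_cyc_edge; try lia; split.
- lia.
- move: wE; case: ifP; lia.
apply/setP => v; rewrite -(permKV s v); set x := (s^-1)%g v.
rewrite !in_setD1 !(inj_eq perm_inj) !mem_cyc_edge; try lia.
have vE (y : 'I_n) : (x == y) = (nat_of_ord x == nat_of_ord y) by [].
rewrite !vE wE; have := ltn_ord x.
by case: ifP; lia.
Qed.

(* With the starting vertices fixed, the edges of the cycle determine the next
   vertex: among them the only one meeting the already determined initial segment
   exactly in its last [r - 1] vertices is the next one. *)
Lemma ham_cycle_inj s t : 1 < r <= n -> ham_cycle r s = ham_cycle r t ->
  (forall i, i < r -> s i = t i) -> s = t.
Proof.
case/andP=> r1 rn st init; apply/permP.
suff P m : forall i, i < m -> s i = t i by move=> i; apply: (P n).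
elim: m => // m IH i; rewrite ltnS leq_eqVlt => /predU1P[im|]; last exact: IH.
case: (ltnP i r) => [/init //|ri].
have ni := ltn_ord i; rewrite -im in IH.
have jn : i - r + 1 < n by lia.
pose j := Ordinal jn.
have : cyc_edge r s j \in ham_cycle r t by rewrite -st; apply/imsetP; exists j.
case/imsetP => k _ E; have kn := ltn_ord k.
have S x : (s x \in cyc_edge r t k) = (i - r < x <= i).
  by rewrite -E mem_cyc_edge //=; have := ltn_ord x; lia.
have M (x : 'I_n) : x < i -> ((k <= x < k + r) || (x + n < k + r)) = (i - r < x).
  by move=> xi; rewrite -(mem_cyc_edge t) // -IH // S; lia.
have n0 : 0 < n by lia.
have i1 : i - 1 < n by lia.
have ir : i - r < n by lia.
(* Edge [k] of [t] contains the positions [j] and [i - 1] but neither 0 nor [i - r]; this pins its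
   start to [i - r + 1]. *)
have := M (Ordinal n0); have := M j; have := M (Ordinal i1); have := M (Ordinal ir).
rewrite /= => M1 M2 M3 M4.
have kE : k = i - r + 1 :> nat by lia.
have : t i \in cyc_edge r s j by rewrite E mem_cyc_edge //; lia.
rewrite -(permKV s (t i)) mem_cyc_edge //= => H.
set x := (s^-1)%g (t i) in H.
have sx : s x = t i by rewrite permKV.
have [xi|ix|/val_inj xi] := ltngtP x i.
- have := IH x xi; rewrite sx => /perm_inj xi'; move: xi; rewrite xi'; lia.
- have := ltn_ord x; lia.
by rewrite -xi sx xi.
Qed.

(** A cycle together with the vertices at the first [r] positions determines the ordering. The
    polynomial factor [n ^ r] is later absorbed by the exponential gain. *)
Lemma card_perm_ham (G : {set {set 'I_n}}) : 1 < r <= n ->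
  #|[set s : {perm 'I_n} | ham_cycle r s \subset G]| <= Hcount r G * n ^ r.
Proof.
move=> rn; pose h s : {set {set 'I_n}} * {ffun 'I_r -> 'I_n} :=
  (ham_cycle r s, [ffun j => s (widen_ord (proj2 (andP rn)) j)]).
set A := [set s | _].
have hinj : {in A &, injective h}.
  move=> s t _ _ [st /ffunP init]; apply: ham_cycle_inj => // i ir.
  have := init (Ordinal ir); rewrite !ffunE.
  by have -> : widen_ord (proj2 (andP rn)) (Ordinal ir) = i by apply: val_inj.
rewrite -(card_in_imset hinj).
apply: (@leq_trans #|setX [set ham_cycle r s | s in A] [set: {ffun 'I_r -> 'I_n}]|).
  apply/subset_leq_card/subsetP => _ /imsetP[s sA ->].
  by rewrite !inE /= imset_f.
rewrite cardsX cardsT card_ffun !card_ord leq_mul2r; apply/orP; right.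
apply/subset_leq_card/subsetP => _ /imsetP[s sA ->].
by apply/imsetP; exists s => //; move: sA; rewrite !inE.
Qed.

End TightCycles.

(** * Random signs and nonnegative Fourier coefficients *)

Section RandomSigns.
Import Order.TTheory GRing.Theory Num.Theory.
Local Open Scope ring_scope.
Context {R : realType} {V : finType}.
Implicit Types (Y : {set {set V}}) (S e : {set V}) (f g : {set {set V}} -> R).

Definition fair (S : {set V}) : R := 1 / 2.

Lemma fair01 S : 0 <= fair S <= 1.
Proof. by rewrite /fair; apply/andP; split; lra. Qed.

(** [Y] is the random set of those [S] whose sign is +1. *)
Definition sgn Y S : R := if S \in Y then 1 else -1.

Lemma sgn_sqr Y S : sgn Y S * sgn Y S = 1.
Proof. by rewrite /sgn; case: ifP => _; ring. Qed.

Lemma prod_seq_count (I : finType) (l : seq I) (F : I -> R) :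
  \prod_(i <- l) F i = \prod_i F i ^+ count_mem i l.
Proof.
elim: l => [|a l IH]; first by rewrite big_nil big1.
rewrite big_cons IH (bigD1 a) //= [RHS](bigD1 a) //= eqxx exprS mulrA.
congr (_ * _); apply: eq_bigr => i; rewrite eq_sym => /negbTE -> //.
Qed.

(* [l] may have repetitions: since signs square to 1, these are exactly the Fourier
   coefficients of [f]. *)
Definition fourier_nneg f := forall l : seq {set V},
  0 <= expect fair (fun Y => f Y * \prod_(S <- l) sgn Y S).

Lemma eq_fourier_nneg f g : f =1 g -> fourier_nneg f -> fourier_nneg g.
Proof. by move=> fg + l => /(_ l); under eq_expect do rewrite fg. Qed.

(** By independence each [S] contributes the mean of a power of its sign: 1 for even multiplicity in
    [l], 0 for odd. *)
Lemma fourier_nneg1 : fourier_nneg (fun=> 1).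
Proof.
move=> l; pose h (S : {set V}) b : R := (if b then 1 else -1) ^+ count_mem S l.
rewrite (@eq_expect _ _ _ _ (fun Y => \prod_S h S (S \in Y))); last first.
  by move=> Y; rewrite mul1r (prod_seq_count _ l); apply: eq_bigr.
rewrite (expect_prod fair h); apply: prodr_ge0 => S _; rewrite /h /fair expr1n -signr_odd.
by case: (odd _); rewrite ?expr0 ?expr1; lra.
Qed.

Lemma fourier_nnegD f g : fourier_nneg f -> fourier_nneg g ->
  fourier_nneg (fun Y => f Y + g Y).
Proof.
move=> f0 g0 l; under eq_expect do rewrite mulrDl.
by rewrite expectD addr_ge0.
Qed.

Lemma fourier_nnegZ c f : 0 <= c -> fourier_nneg f -> fourier_nneg (fun Y => c * f Y).
Proof.
move=> c0 f0 l; under eq_expect do rewrite -mulrA.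
by rewrite expectZ mulr_ge0.
Qed.

(** The extra sign is absorbed by the test list: [l] becomes [S :: l]. *)
Lemma fourier_nneg_sgn S f : fourier_nneg f -> fourier_nneg (fun Y => sgn Y S * f Y).
Proof.
move=> f0 l; have := f0 (S :: l); congr (0 <= _); apply: eq_expect => Y.
by rewrite big_cons; ring.
Qed.

(** The filter [P] makes it possible to split one distinguished sign off the sum. *)
Lemma fourier_nneg_sum e (P : pred V) f : fourier_nneg f ->
  fourier_nneg (fun Y => (\sum_(v in e | P v) sgn Y (e :\ v)) * f Y).
Proof.
move=> f0 l; under eq_expect do rewrite -mulrA big_distrl /=.
rewrite expect_sum; apply: sumr_ge0 => v _.
have := fourier_nneg_sgn (e :\ v) _ f0 l; congr (0 <= _).
by apply: eq_expect => Y; rewrite mulrA.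
Qed.

Variable d : R.

Definition edge_weight Y e : R := 1 + d * \sum_(v in e) sgn Y (e :\ v).

Lemma edge_weight_bound Y e : 0 <= d -> `|edge_weight Y e - 1| <= d * #|e|%:R.
Proof.
move=> d0; rewrite /edge_weight addrAC subrr add0r normrM (ger0_norm d0) ler_wpM2l //.
apply: le_trans (ler_norm_sum _ _ _) _; rewrite -sum1_card natr_sum.
by apply: ler_sum => v _; rewrite /sgn; case: ifP; rewrite ?normrN normr1.
Qed.

Lemma fourier_nneg_weight e f : 0 <= d -> fourier_nneg f ->
  fourier_nneg (fun Y => edge_weight Y e * f Y).
Proof.
move=> d0 f0.
have := fourier_nnegD _ _ f0 (fourier_nnegZ _ _ d0 (fourier_nneg_sum e predT _ f0)).
apply: eq_fourier_nneg => Y; rewrite /edge_weight.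
under eq_bigl do rewrite andbT. ring.
Qed.

(* The two weights share the sign of [e1 :\ v1], whose square contributes [d ^+ 2]. *)
Lemma fourier_nneg_weight2 e1 e2 v1 v2 f : 0 <= d -> v1 \in e1 -> v2 \in e2 ->
  e1 :\ v1 = e2 :\ v2 -> fourier_nneg f ->
  fourier_nneg (fun Y => edge_weight Y e1 * (edge_weight Y e2 * f Y)
     + - (1 + d ^+ 2) * f Y).
Proof.
move=> d0 ve1 ve2 E f0.
have A0 := fourier_nneg_sum e1 (predC1 v1); have B0 := fourier_nneg_sum e2 (predC1 v2).
have y0 := fourier_nneg_sgn (e1 :\ v1).
have D0 := fourier_nnegD; have Z0 := fourier_nnegZ _ _ d0.
(* With [y] the shared sign and [A], [B] the remaining sums, [y^2 = 1] turns the product of the two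
   weights minus [1 + d^2] into [d (y + A) + d (y + B) + d^2 (y B + y A + A B)], a sum of terms with
   nonnegative coefficients. *)
have := D0 _ _ (D0 _ _ (Z0 _ (D0 _ _ (y0 _ f0) (A0 _ f0))) (Z0 _ (D0 _ _ (y0 _ f0) (B0 _ f0))))
  (Z0 _ (Z0 _ (D0 _ _ (D0 _ _ (y0 _ (B0 _ f0)) (y0 _ (A0 _ f0))) (A0 _ (B0 _ f0))))).
apply: eq_fourier_nneg => Y; rewrite /edge_weight.
have -> : \sum_(v in e1) sgn Y (e1 :\ v) = sgn Y (e1 :\ v1) +
    \sum_(v in e1 | predC1 v1 v) sgn Y (e1 :\ v) by rewrite (bigD1 v1).
have -> : \sum_(v in e2) sgn Y (e2 :\ v) = sgn Y (e1 :\ v1) +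
    \sum_(v in e2 | predC1 v2 v) sgn Y (e2 :\ v) by rewrite (bigD1 v2) // E.
set y := sgn Y _; set A := \sum_(_ in e1 | _) _; set B := \sum_(_ in e2 | _) _.
have y2 : y * y = 1 := sgn_sqr _ _; ring: y2.
Qed.

(** Weights are peeled off two at a time. The excess of a consecutive pair over [1 + d^2], times the
    remaining product, has nonnegative coefficients, hence nonnegative mean; a single leftover
    weight has mean at least 1. *)
Lemma expect_prod_weight (e : nat -> {set V}) m : 0 <= d ->
  (forall i, i.+1 < m -> exists v v', [/\ v \in e i, v' \in e i.+1 &
     e i :\ v = e i.+1 :\ v'])%N ->
  (1 + d ^+ 2) ^+ m./2 <= expect fair (fun Y => \prod_(i < m) edge_weight Y (e i)).
Proof.
move=> d0; pose F k Y : R := \prod_(i < k) edge_weight Y (e i).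
have F1 k : fourier_nneg (F k).
  elim: k => [|k IH].
    by apply: eq_fourier_nneg fourier_nneg1 => Y; rewrite /F big_ord0.
  apply: eq_fourier_nneg (fourier_nneg_weight (e k) _ d0 IH) => Y.
  by rewrite /F big_ord_recr mulrC.
have E0 f : fourier_nneg f -> 0 <= expect fair f.
  by move/(_ [::]); under eq_expect do rewrite big_nil mulr1.
have c0 : 0 <= 1 + d ^+ 2 by rewrite addr_ge0 ?sqr_ge0.
rewrite -/(F m); elim/ltn_ind: m => -[|[|k]] IH Hch.
- rewrite expr0 (@eq_expect _ _ _ _ (fun=> 1)) ?expect1 // => Y; exact: big_ord0.
- have := E0 _ (fourier_nneg_sum (e 0%N) predT _ fourier_nneg1).
  rewrite expr0 (@eq_expect _ _ _ (F 1) (fun Y => 1 +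
      d * ((\sum_(v in e 0 | predT v) sgn Y (e 0%N :\ v)) * 1))); last first.
    by move=> Y; rewrite /F big_ord_recr big_ord0 /= /edge_weight mul1r mulr1;
       under [in RHS]eq_bigl do rewrite andbT.
  by rewrite expectD expect1 expectZ lerDl => /(mulr_ge0 d0).
have [v [v' [ve ve' E]]] := Hch k (ltnSn _).
have := E0 _ (fourier_nneg_weight2 _ _ _ _ _ d0 ve ve' E (F1 k)).
rewrite expectD expectZ mulNr subr_ge0 => H.
rewrite /= exprS; apply: (@le_trans _ _ ((1 + d ^+ 2) * expect fair (F k))).
  by apply: ler_wpM2l => //; apply: IH => [|i ik]; [lia|apply: Hch; lia].
apply: (le_trans H); rewrite le_eqVlt; apply/orP; left; apply/eqP; apply: eq_expect => Y.
rewrite /F !big_ord_recr /=; ring.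
Qed.

Lemma sum_sgn Y (B : {set {set V}}) : \sum_(S in B) sgn Y S = 2 * deviation fair B Y.
Proof.
rewrite /deviation -sum1_card natr_sum mulrBr !big_distrr /=.
rewrite (eq_bigr (fun S => 2 * (if S \in Y then 1 else 0) - 2 * fair S)); last first.
  by move=> S _; rewrite /sgn /fair; case: ifP => _; field.
rewrite sumrB; congr (_ - _); rewrite -!big_distrr -big_mkcondr /=.
by congr (_ * _); apply: eq_bigl => S; rewrite inE andbC.
Qed.

(** Double counting: each [q]-set [S] arises as [e :\ v] once for every [v] outside [S]. *)
Lemma sum_edge_weight Y q :
  \sum_(e : {set V} | #|e| == q.+1) edge_weight Y e =
  'C(#|V|, q.+1)%:R + d * ((#|V| - q)%:R * \sum_(S : {set V} | #|S| == q) sgn Y S).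
Proof.
rewrite big_split /= -big_distrr /=; congr (_ + _ * _).
  by rewrite -card_draws -sum1_card natr_sum; apply: eq_bigl => e; rewrite inE.
rewrite (exchange_big_dep xpredT) //=.
transitivity (\sum_v \sum_(S : {set V} | (#|S| == q) && (v \notin S)) sgn Y S).
  apply: eq_bigr => v _.
  rewrite (reindex_onto (fun S => v |: S) (fun e => e :\ v)) /=; last first.
    by move=> e /andP[_ ve]; rewrite setD1K.
  apply: eq_big => [S|S /andP[_ /eqP ->] //].
  rewrite setU11 andbT cardsU1; case: (boolP (v \in S)) => [vS|vS]; last first.
    by rewrite setU1K // eqxx /= !andbT add1n eqSS.
  rewrite andbF; apply/negbTE/negP => /andP[_ /eqP /setP/(_ v)].
  by rewrite !inE eqxx vS.
rewrite (exchange_big_dep (fun S => #|S| == q)) /=; last by move=> v S _ /andP[].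
rewrite big_distrr /=; apply: eq_bigr => S /eqP qS.
rewrite sumr_const mulr_natl; congr (_ *+ _).
have := cardsC S; rewrite qS => <-; rewrite addKn cardsE.
by apply: eq_card => v; rewrite unfold_in /= eqxx unfold_in.
Qed.

End RandomSigns.

(** * Fixing the signs: weights with controlled total and large cycle products *)

Section GoodWeights.
Import Order.TTheory GRing.Theory Num.Theory.
Local Open Scope ring_scope.
Context {R : realType}.

Lemma expect_weight_cycle n r (d : R) (s : {perm 'I_n}) : 0 <= d -> (0 < r < n)%N ->
  (1 + d ^+ 2) ^+ n./2 <= expect fair (fun Y => \prod_i edge_weight d Y (cyc_edge r s i)).
Proof.
move=> d0 /andP[r0 rn]; case: n s rn => // n s rn.
pose e k := cyc_edge r s (inord k).
have := expect_prod_weight d e n.+1 d0; move/(_ _)/le_trans; apply.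
  by move=> i ik; apply: (@cyc_edge_shift) => //; rewrite !inordK //; lia.
apply: le_expect => [S|Y]; first exact: fair01.
by rewrite (eq_bigr (fun i => edge_weight d Y (cyc_edge r s i))) // => i _; rewrite /e inord_val.
Qed.

(** The first-moment argument is applied to [Z Y] minus a penalty [n! 2^n] on sign choices with
    large deviation. The penalty costs at most [n! / 2] on average, and it is at least [Z Y], so a
    choice with positive value cannot be bad. *)
Lemma exists_good_weight n r (d lam : R) : 0 <= d -> d * r%:R <= 1 -> (0 < r < n)%N ->
  0 < lam <= 1 / 2 ->
  2 ^+ n * (2 * expR (- (2 * lam ^+ 2 * 'C(n, r.-1)%:R))) <= 1 / 2 ->
  exists w : {set 'I_n} -> R,
  [/\ forall e : {set 'I_n}, #|e| = r -> `|w e - 1| <= d * r%:R,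
      `|\sum_(e : {set 'I_n} | #|e| == r) w e - 'C(n, r)%:R| <= 8 * lam * d * r%:R * 'C(n, r)%:R
    & (1 + d ^+ 2) ^+ n./2 / 2 * n`!%:R <=
      \sum_(s : {perm 'I_n}) \prod_i w (cyc_edge r s i)].
Proof.
move=> d0 dr1 rn lam01 small; have [r0 {}rn] := andP rn; set D := 1 + d ^+ 2.
pose B := [set S : {set 'I_n} | #|S| == r.-1].
have cB : #|B| = 'C(n, r.-1) by rewrite card_draws card_ord.
pose bad Y := 4 * lam * #|B|%:R <= `|deviation (@fair R _) B Y|.
pose Z Y := \sum_(s : {perm 'I_n}) \prod_i edge_weight d Y (cyc_edge r s i).
have card_perm : #|{perm 'I_n}| = n`! by rewrite card_Sn.
have wb Y (e : {set 'I_n}) : #|e| = r -> `|edge_weight d Y e - 1| <= d * r%:R.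
  by move=> <-; apply: edge_weight_bound.
(* Each weight lies in [[0, 2]] because [d r <= 1]. *)
have Zb Y : Z Y <= n`!%:R * 2 ^+ n.
  rewrite -card_perm mulr_natl -sumr_const; apply: ler_sum => s _.
  rewrite -[X in _ ^+ X]card_ord -prodr_const; apply: ler_prod => i _.
  have := wb Y _ (card_cyc_edge s i (ltnW rn)); rewrite ler_norml => /andP[h1 h2].
  by apply/andP; split; lra.
have D1 : 1 <= D by rewrite lerDl sqr_ge0.
have Dn : 1 <= D ^+ n./2 by rewrite exprn_ege1.
have [Y YZ] : exists Y, D ^+ n./2 / 2 * n`!%:R <= Z Y + - (n`!%:R * 2 ^+ n) * (bad Y)%:R.
  apply: (@expect_exists _ _ fair (fair01)).
  rewrite expectD expectZ expect_sum.
  have h1 : n`!%:R * D ^+ n./2 <= \sum_(s : {perm 'I_n})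
      expect fair (fun Y => \prod_i edge_weight d Y (cyc_edge r s i)).
    rewrite -card_perm mulr_natl -sumr_const; apply: ler_sum => s _.
    by apply: expect_weight_cycle => //; rewrite r0.
  have := chernoff _ (@fair01 R _) B _ lam01; rewrite cB => h2.
  have h3 : 2 ^+ n * expect fair (fun Y => (bad Y)%:R) <= 1 / 2 :> R.
    apply: le_trans small; apply: ler_wpM2l; first by rewrite exprn_ge0.
    by rewrite /bad cB.
  have nf : 0 <= n`!%:R :> R by [].
  apply: le_trans (lerD h1 (lexx _)); rewrite mulNr -mulrA.
  have := ler_wpM2l nf h3.
  have := ler_wpM2l nf Dn.
  lra.
have pos : 0 < D ^+ n./2 / 2 * n`!%:R.
  by rewrite mulr_gt0 ?ltr0n ?fact_gt0 //; lra.
move: YZ; case: (boolP (bad Y)) => /= [_|/negP good] YZ.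
  have := Zb Y; rewrite mulr1n in YZ; lra.
exists (edge_weight d Y); split; first exact: wb.
  have := sum_edge_weight d Y r.-1; rewrite prednK // => ->.
  rewrite card_ord [X in `|X|](_ : _ = d * ((n - r.-1)%:R * (2 * deviation fair B Y))); last first.
    by rewrite -sum_sgn addrAC subrr add0r; under [in RHS]eq_bigl do rewrite inE.
  have /negP := good; rewrite -ltNge => /ltW dev.
  (* This identity rescales the deviation of the signs, measured against ['C(n, r.-1)], to the
     number of [r]-sets. *)
  have ndr : ((n - r.-1) * 'C(n, r.-1) = r * 'C(n, r))%N.
    by rewrite -mul_bin_left prednK.
  rewrite normrM (ger0_norm d0) normrM normr_nat normrM (ger0_norm (ler0n _ 2)).
  have := ler_wpM2l d0 (ler_wpM2l (ler0n R (n - r.-1)) dev).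
  rewrite cB.
  have : (n - r.-1)%:R * 'C(n, r.-1)%:R = r%:R * 'C(n, r)%:R :> R by rewrite -!natrM ndr.
  set a := (n - r.-1)%:R; set b := 'C(n, r.-1)%:R; set c := 'C(n, r)%:R => E.
  have -> : d * (a * (4 * lam * b)) = 4 * lam * d * (a * b) by ring.
  rewrite E; set x := `|_|; lra.
by move: YZ; rewrite /= mulr0n mulr0 addr0.
Qed.

End GoodWeights.

(** * From edge probabilities to a quasi-random hypergraph of exact density *)

Lemma exists_subset_card (T : finType) (A : {set T}) m : m <= #|A| ->
  exists2 B : {set T}, B \subset A & #|B| = m.
Proof.
rewrite cardE => mA; exists [set x in take m (enum A)].
  by apply/subsetP => x; rewrite inE => /mem_take; rewrite mem_enum.
by rewrite cardsE (card_uniqP _) ?take_uniq ?enum_uniq // size_takel.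
Qed.

Section RandomHypergraph.
Import Order.TTheory GRing.Theory Num.Theory.
Local Open Scope ring_scope.
Context {R : realType}.

(** Repeated values of [h] only insert further factors from [[0, 1]] on the left. It is applied to
    cycles, whose edge set is an image. *)
Lemma prod_le_prod_imset (I T : finType) (h : I -> T) (F : T -> R) :
  (forall x, 0 <= F x <= 1) -> \prod_(i in I) F (h i) <= \prod_(x in [set h i | i in I]) F x.
Proof.
move=> F01; rewrite (partition_big_imset h) /=; apply: ler_prod => _ /imsetP[i _ ->].
rewrite prodr_ge0 => [|j _]; last by case/andP: (F01 (h j)).
have F0 := proj1 (andP (F01 (h i))).
rewrite (bigD1 i) ?inE ?eqxx //= -[leRHS]mulr1 ler_wpM2l //.
apply: prodr_ile1 => j _; exact: F01.
Qed.

(** The mass of [pi] stays below [p 'C(n, r)] by a margin covering the fluctuation [4 lam 'C(n, r)],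
    so the random graph has at most [k] edges and lacks at most [xi 'C(n, r)]. Induced densities
    move by at most [eps / 4] for each of three reasons: [pi] against [p], random fluctuation, and
    the added edges (via [Q xi]). *)
Lemma exists_quasi_random n r k (p eps lam Q xi A : R) (pi : {set 'I_n} -> R) :
  (0 < r < n)%N -> 0 < p < 1 -> p * 'C(n, r)%:R = k%:R ->
  'C(n, r)%:R <= Q * 'C(n./2, r)%:R -> Q * xi <= eps / 4 -> 0 < eps ->
  0 < lam <= 1 / 2 -> 4 * lam <= eps / 4 -> 0 < A ->
  (forall e : {set 'I_n}, #|e| = r -> 0 <= pi e <= 1) ->
  (forall e : {set 'I_n}, #|e| = r -> `|pi e - p| <= eps / 4) ->
  (let S := \sum_(e : {set 'I_n} | #|e| == r) pi e in
    S + 4 * lam * 'C(n, r)%:R <= p * 'C(n, r)%:R <= S + (xi - 4 * lam) * 'C(n, r)%:R) ->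
  A * n`!%:R <= \sum_(s : {perm 'I_n}) \prod_i pi (cyc_edge r s i) ->
  2 ^+ n * (4 * expR (- (2 * lam ^+ 2 * 'C(n./2, r)%:R))) <= A / 2 ->
  exists G : {set {set 'I_n}}, [/\ is_rgraph r G, #|G| = k,
    forall W : {set 'I_n}, #|W| = n./2 ->
      p - eps < (induced_edges G W)%:R / 'C(#|W|, r)%:R < p + eps &
    A / 2 * n`!%:R <= #|[set s : {perm 'I_n} | ham_cycle r s \subset G]|%:R].
Proof.
move=> /andP[r0 rn] /andP[p0 p1] pk NQ Qxi eps0 lam01 lame A0 pi01 pip /andP[S1 S2] HA small.
(* Probabilities are set to 0 off the [r]-sets, where nothing is assumed about [pi]. *)
pose pi' (e : {set 'I_n}) := if #|e| == r then pi e else 0.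
have pi'01 e : 0 <= pi' e <= 1.
  by rewrite /pi'; case: eqP => [/pi01 //|_]; rewrite lexx ler01.
set N := 'C(n, r)%:R in pk NQ S1 S2 HA; set N' := 'C(n./2, r)%:R in NQ small.
have N'N : N' <= N.
  by rewrite ler_nat; apply: leq_bin2l; rewrite -{2}(odd_double_half n) -addnn addnA leq_addl.
have N0 : 0 < N by rewrite ltr0n bin_gt0 ltnW.
have N'0 : 0 < N'.
  by rewrite lt_neqAle ler0n andbT; apply: contraTneq NQ => <-; rewrite mulr0 -ltNge.
pose K := [set e : {set 'I_n} | #|e| == r].
pose KW (W : {set 'I_n}) := [set e : {set 'I_n} | e \subset W & #|e| == r].
have cK : #|K| = 'C(n, r) by rewrite card_draws card_ord.
have cKW W : #|KW W| = 'C(#|W|, r) by rewrite cards_draws.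
pose bad (B J : {set {set 'I_n}}) := 4 * lam * #|B|%:R <= `|deviation pi' B J|.
pose ham (J : {set {set 'I_n}}) : R := \sum_(s : {perm 'I_n}) (ham_cycle r s \subset J)%:R.
pose bads J : R := (bad K J)%:R + \sum_(W : {set 'I_n} | #|W| == n./2) (bad (KW W) J)%:R.
have fact0 : 0 < n`!%:R :> R by rewrite ltr0n fact_gt0.
have hamE J : ham J = #|[set s : {perm 'I_n} | ham_cycle r s \subset J]|%:R.
  by rewrite /ham -natr_sum -sum1_card big_mkcond /=; congr (_%:R); rewrite [RHS]big_mkcond;
     apply: eq_bigr => s _; rewrite inE; case: (_ \subset _).
have ham_le J : ham J <= n`!%:R.
  by rewrite hamE ler_nat -(card_Sn n) max_card.
have E : 2 * expR (- (2 * lam ^+ 2 * N)) <= 2 * expR (- (2 * lam ^+ 2 * N')) :> R.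
  rewrite ler_pM2l // ler_expR lerN2.
  have l2 : 0 <= 2 * lam ^+ 2 by rewrite mulr_ge0 // sqr_ge0.
  exact: (ler_wpM2l l2 N'N).
(* Every bad event is charged [n!], which is at least [ham J]; since the value found is positive, no
   bad event occurs. The union bound keeps the expected charge below [A / 2] times [n!]. *)
have [J HJ] : exists J, A / 2 * n`!%:R <= ham J + - n`!%:R * bads J.
  apply: (expect_exists pi' pi'01); rewrite expectD expectZ expectD !expect_sum.
  have h1 : A * n`!%:R <= \sum_(s : {perm 'I_n})
      expect pi' (fun J : {set {set 'I_n}} => (ham_cycle r s \subset J)%:R).
    apply: le_trans HA _; apply: ler_sum => s _; rewrite expect_supset.
    apply: le_trans (prod_le_prod_imset _ _ (cyc_edge r s) _ pi'01).
    rewrite le_eqVlt; apply/orP; left; apply/eqP/eq_bigr => i _.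
    by rewrite /pi' card_cyc_edge ?eqxx // ltnW.
  have h2 := chernoff _ pi'01 K _ lam01; rewrite {2}cK in h2.
  have h3 : \sum_(W : {set 'I_n} | #|W| == n./2) expect pi' (fun J => (bad (KW W) J)%:R)
      <= 2 ^+ n * (2 * expR (- (2 * lam ^+ 2 * N'))).
    have c2 : #|{set 'I_n}| = (2 ^ n)%N by rewrite -cardsT -powersetT card_powerset cardsT card_ord.
    rewrite -natrX mulr_natl -c2 -sumr_const big_mkcond /=; apply: ler_sum => W _.
    case: eqP => [cW|_]; last by rewrite mulr_ge0 ?expR_ge0.
    by have := chernoff _ pi'01 (KW W) _ lam01; rewrite {2}cKW cW.
  have t1 : 1 <= 2 ^+ n :> R by rewrite exprn_ege1 // ler1n.
  have t2 := ler_wpM2r (expR_ge0 (- (2 * lam ^+ 2 * N'))) t1.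
  have t3 : expect pi' (fun J => (bad K J)%:R) +
     \sum_(W : {set 'I_n} | #|W| == n./2) expect pi' (fun J => (bad (KW W) J)%:R) <= A / 2.
    apply: le_trans small; apply: le_trans (lerD (le_trans h2 E) h3) _.
    set x := expR _ in t2 *; lra.
  have t4 := ler_wpM2l (ltW fact0) t3.
  set x := n`!%:R in h1 t4 *; rewrite mulNr; lra.
have bad0 B : 0 <= (bad B J)%:R :> R by [].
have pos : 0 < A / 2 * n`!%:R by rewrite mulr_gt0 // divr_gt0.
have bads1 : bads J < 1.
  rewrite ltNge; apply/negP => b1.
  have := ler_wpM2l (ltW fact0) b1; have := ham_le J; lra.
have goodK : ~~ bad K J.
  apply/negP => bK; move: bads1; rewrite /bads bK mulr1n; apply/negP; rewrite -leNgt lerDl.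
  exact: sumr_ge0.
have goodW (W : {set 'I_n}) : #|W| = n./2 -> ~~ bad (KW W) J.
  move=> cW; apply/negP => bW; move: bads1; rewrite /bads (bigD1 W) ?cW //= bW mulr1n.
  apply/negP; rewrite -leNgt addrCA lerDl addr_ge0 //; exact: sumr_ge0.
have bads0 : 0 <= bads J by rewrite addr_ge0 // sumr_ge0.
have {HJ} HJ : A / 2 * n`!%:R <= ham J.
  by apply: le_trans HJ _; rewrite mulNr gerDl oppr_le0 mulr_ge0 // ltW.
have piK : \sum_(i in K) pi' i = \sum_(e : {set 'I_n} | #|e| == r) pi e.
  by apply: eq_big => [e|e]; rewrite inE // /pi' => ->.
have piKW (W : {set 'I_n}) : #|W| = n./2 ->
    (p - eps / 4) * N' <= \sum_(i in KW W) pi' i <= (p + eps / 4) * N'.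
  move=> cW; rewrite !mulr_natr /N' -cW -cKW -!sumr_const.
  apply/andP; split; apply: ler_sum => e; rewrite inE => /andP[_ er];
    have := pip e (eqP er); rewrite /pi' er ler_norml; clear => /andP[? ?]; lra.
move: goodK; rewrite /bad /deviation cK piK -/N -ltNge ltr_norml => /andP[gK1 gK2].
have JKk : (#|J :&: K| <= k)%N by rewrite -(ler_nat R) -pk; lra.
(* [X] fills up the edge count to exactly [k]; cycles already present survive. *)
have [X XK cX] : exists2 X : {set {set 'I_n}}, X \subset K :\: J & #|X| = (k - #|J :&: K|)%N.
  apply: exists_subset_card; rewrite cardsD setIC cK leq_sub2r // -(ler_nat R) -pk -/N.
  by rewrite ger_pMl //; lra.
exists ((J :&: K) :|: X); split.
- apply/forall_inP => e; rewrite !inE => /orP[/andP[_ ->] //|/(subsetP XK)].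
  by rewrite !inE => /andP[_ ->].
- rewrite cardsU cX (_ : _ :&: X = set0) ?cards0 ?subn0 ?subnKC //.
  apply/setP => e; rewrite !inE; apply/negP => /andP[/andP[eJ _] /(subsetP XK)].
  by rewrite !inE eJ.
- move=> W cW; rewrite cW -/N'.
  have := goodW W cW; rewrite /bad /deviation cKW cW -/N' -ltNge ltr_norml => /andP[g1 g2].
  have /andP[q1 q2] := piKW W cW.
  have i1 : (#|J :&: KW W| <= induced_edges (J :&: K :|: X) W)%N.
    apply/subset_leq_card/subsetP => e; rewrite !inE => /andP[-> /andP[-> ->]] //.
  have i2 : (induced_edges (J :&: K :|: X) W <= #|J :&: KW W| + #|X|)%N.
    apply: leq_trans (leq_card_setU _ _); apply/subset_leq_card/subsetP => e.
    by rewrite !inE => /andP[/orP[/andP[-> ->]|->] ->] //; rewrite orbT.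
  have cXR : #|X|%:R = p * N - #|J :&: K|%:R by rewrite cX natrB // pk.
  move: i1 i2; rewrite -!(ler_nat R) natrD cXR => i1 i2.
  have x1 : xi * N <= eps / 4 * N'.
    have xi0 : 0 <= xi.
      have : 0 <= (xi - 8 * lam) * N by clear -S1 S2; lra.
      by rewrite pmulr_lge0 // => h; have /andP[l0 _] := lam01; clear -h l0; lra.
    have := ler_wpM2l xi0 NQ; have := ler_wpM2r (ltW N'0) Qxi; clear; lra.
  rewrite ltr_pdivlMr // ltr_pdivrMr //.
  have := ler_wpM2r (ltW N'0) lame.
  have := mulr_gt0 eps0 N'0.
  by clear -g1 g2 q1 q2 i1 i2 x1 gK1 S2 => *; apply/andP; split; lra.
apply: le_trans HJ _; rewrite hamE ler_nat; apply/subset_leq_card/subsetP => s.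
rewrite !inE => sJ; apply/subsetP => _ /imsetP[i _ ->].
rewrite !inE card_cyc_edge ?eqxx ?andbT; last exact: ltnW.
by rewrite (subsetP sJ) // imset_f.
Qed.

End RandomHypergraph.

(** * Binomial and exponential estimates, and the choice of parameters *)

(** Falling factorials are compared factor by factor: [n - j <= 4 (n./2 - j)] for [j < r]. *)
Lemma bin_half_le n r : 4 * r <= n -> 'C(n, r) <= 4 ^ r * 'C(n./2, r).
Proof.
move=> rn; rewrite -(leq_pmul2r (fact_gt0 r)) -mulnA !bin_ffact.
suff P j : j <= r -> n ^_ j <= 4 ^ j * (n./2) ^_ j by apply: P.
elim: j => [|j IH] jr; first by rewrite !ffactn0.
rewrite !ffactnSr expnSr mulnACA; apply: leq_mul; first by apply: IH; lia.
lia.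
Qed.

(** By Pascal's rule ['C(m, k)] is at least ['C(m - (k - 2), 2)], which is quadratic in [n]. It
    serves both the signs ([k = r - 1], where [r >= 3] enters) and the edges inside a half
    ([k = r]). *)
Lemma sqr_le_bin n m k : 2 <= k -> 4 * k + 16 <= n -> n./2 <= m -> n ^ 2 <= 64 * 'C(m, k).
Proof.
move=> k2 kn nm.
have mono x j : 'C(x, 2) <= 'C(x + j, j.+2).
  by elim: j => [|j IH]; rewrite ?addn0 // addnS binS (leq_trans IH) ?leq_addl.
have := mono (m - (k - 2)) (k - 2).
have -> : m - (k - 2) + (k - 2) = m by lia.
have -> : (k - 2).+2 = k by lia.
move=> H; apply: leq_trans (leq_mul (leqnn 64) H).
set x := m - (k - 2).
have x1 : 4 * x >= n by lia.
have -> : 64 * 'C(x, 2) = 32 * (x * (x - 1)).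
  by have := mul_bin_left x 1; rewrite bin1; lia.
have x2 : 8 * (x - 1) >= n by lia.
have := leq_mul x1 x2; rewrite expnS expn1; lia.
Qed.

Section Asymptotics.
Import Order.TTheory GRing.Theory Num.Theory.
Local Open Scope ring_scope.
Context {R : realType}.

Lemma bernoulli_ineq (q : R) n : 0 <= q -> 1 + n%:R * q <= (1 + q) ^+ n.
Proof.
move=> q0; elim: n => [|n IH]; first by rewrite mul0r addr0 expr0.
rewrite exprS; apply: le_trans (ler_wpM2l _ IH); last by lra.
rewrite -natr1; have : 0 <= n%:R * q * q by rewrite !mulr_ge0.
lra.
Qed.

(** With [s = r + 1] and [g] about [n / (2 s)], Bernoulli gives [(1 + q)^(g s) >= (g q)^s], a power
    of [n] one higher than [r]; [b] is the value of [g] beyond which this wins. *)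
Lemma poly_le_exp (q c : R) r : 0 < q -> 0 <= c ->
  exists N, forall n, (N <= n)%N -> c * n%:R ^+ r <= (1 + q) ^+ (n./2).
Proof.
move=> q0 c0; set s := r.+1.
pose b := c * (4 * s%:R) ^+ r / q ^+ s.
have b0 : 0 <= b.
  apply: divr_ge0; last by rewrite exprn_ge0 // ltW.
  by rewrite mulr_ge0 // exprn_ge0 // mulr_ge0.
exists ((Num.bound b).+1 * s * 2)%N => n nN; pose g := (n./2 %/ s)%N.
have gs : (g * s <= n./2)%N by rewrite leq_trunc_div.
have hs : (n./2 < g.+1 * s)%N by rewrite ltn_ceil.
have gb : (Num.bound b < g)%N.
  rewrite /g leq_divRL //; lia.
have bg : b <= g%:R.
  apply: ltW; apply: lt_trans (archi_boundP b0) _; by rewrite ltr_nat.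
have n4 : (n <= 4 * s * g)%N by nia.
apply: (@le_trans _ _ ((1 + q) ^+ (g * s))); last by rewrite ler_weXn2l // lerDl ltW.
rewrite exprM; apply: (@le_trans _ _ ((g%:R * q) ^+ s)); last first.
  apply: lerXn2r; rewrite ?nnegrE ?mulr_ge0 ?exprn_ge0 ?addr_ge0 // ?(ltW q0) //.
  by apply: le_trans (bernoulli_ineq _ _ (ltW q0)); rewrite lerDr.
apply: (@le_trans _ _ (c * (4 * s * g)%:R ^+ r)).
  by apply: ler_wpM2l => //; apply: lerXn2r; rewrite ?nnegrE // ler_nat.
have qs : 0 < q ^+ s by rewrite exprn_gt0.
have bE : c * (4 * s%:R) ^+ r = b * q ^+ s by rewrite /b divfK // gt_eqF.
rewrite !natrM [_ ^+ r]exprMn mulrA bE exprMn [g%:R ^+ s]exprS.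
have w0 : 0 <= q ^+ s * g%:R ^+ r by rewrite mulr_ge0 ?exprn_ge0 // ltW.
have := ler_wpM2r w0 bg; clear; lra.
Qed.

(** The exponent is at least [lam^2 n^2 / 32], which exceeds [64 n / p] once
    [n >= 2048 / (p lam^2)]; moreover [exp(64 / p) >= 64 / p]. *)
Lemma expR_beats (p lam : R) n M : 0 < p < 1 -> 0 < lam -> (n ^ 2 <= 64 * M)%N ->
  2048 / (p * lam ^+ 2) <= n%:R -> expR (- (2 * lam ^+ 2 * M%:R)) <= (p / 64) ^+ n.
Proof.
move=> /andP[p0 p1] l0 nM nb.
have h : n%:R * (64 / p) <= 2 * lam ^+ 2 * M%:R.
  have q0 : 0 < p * lam ^+ 2 by rewrite mulr_gt0 ?exprn_gt0.
  rewrite ler_pdivrMr // in nb; rewrite mulrA ler_pdivrMr //.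
  have : (n ^ 2)%:R <= (64 * M)%:R :> R by rewrite ler_nat.
  rewrite natrX natrM => h1.
  have h2 := ler_wpM2l (ler0n R n) nb.
  have h3 := ler_wpM2l (ltW q0) h1.
  have e1 : n%:R * (n%:R * (p * lam ^+ 2)) = p * lam ^+ 2 * n%:R ^+ 2 by ring.
  rewrite e1 in h2; have := le_trans h2 h3; lra.
have e : expR (- (64 / p)) <= p / 64.
  rewrite expRN -[leRHS]invrK lef_pV2 ?posrE ?expR_gt0 ?invr_gt0 ?divr_gt0 //.
  by rewrite invf_div; apply: le_trans (expR_ge1Dx _); lra.
apply: (@le_trans _ _ (expR (- (64 / p)) ^+ n)).
  by rewrite -expRM_natl ler_expR mulrN lerN2.
by apply: lerXn2r; rewrite ?nnegrE ?expR_ge0 ?divr_ge0 // ltW.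
Qed.

(** [d] keeps probabilities in [[0, 1]] and near [p]. Then [th] is small against [d^2], so that the
    loss [(1 - th)^n] is outweighed, and against [eps / Q], for the added edges. Finally [lam] is a
    fraction of the relative margin [p th]. *)
Lemma exists_parameters (p eps Q : R) r : 0 < p < 1 -> 0 < eps -> 1 <= Q -> (0 < r)%N ->
  exists d th lam : R, [/\ [/\ 0 < d, d * r%:R <= 1 / 16, d * r%:R <= (1 - p) / 16,
      d * r%:R <= eps / 16 & d <= 1], [/\ 0 < th, th <= d ^+ 2 / 8 & th * Q <= eps / 64]
    & lam = p * th / 8].
Proof.
move=> /andP[p0 p1] e0 Q1 r0; have rR : 1 <= r%:R :> R by rewrite ler1n.
have r0' : 0 < r%:R :> R by lra.
pose m := Num.min (Num.min eps (1 - p)) 1.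
have m0 : 0 < m by rewrite !lt_min e0 /= ltr01 andbT; lra.
have m1 : m <= 1 by rewrite ge_min lexx orbT.
have m2 : m <= 1 - p by rewrite !ge_min lexx !orbT.
have m3 : m <= eps by rewrite !ge_min lexx.
pose d := m / 16 / r%:R.
have dr : d * r%:R = m / 16 by rewrite /d divfK // gt_eqF.
have d0 : 0 < d by rewrite !divr_gt0.
pose th := Num.min (d ^+ 2 / 8) (eps / 64 / Q).
have Q0 : 0 < Q by lra.
exists d, th, (p * th / 8); split => //; split => //; rewrite ?dr; try lra.
- have : d * 1 <= d * r%:R by rewrite ler_pM2l.
  lra.
- by rewrite lt_min !divr_gt0 ?exprn_gt0.
- by rewrite ge_min lexx.
by rewrite -ler_pdivlMr // ge_min lexx orbT.
Qed.

End Asymptotics.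

(** * Assembling the exponential gain *)

Section Main.
Import Order.TTheory GRing.Theory Num.Theory.
Local Open Scope ring_scope.
Context {R : realType}.

(** Per two vertices, [(1 + d^2 / 32)^3 <= (1 - th)^2 (1 + d^2)]. Two of the three factors form the
    final gain; the third, [(1 + d^2 / 32)^(n./2)], is reserved to pay for polynomial losses. *)
Lemma gain_bound (d th : R) n : 0 < d <= 1 -> 0 < th <= d ^+ 2 / 8 ->
  (1 + d ^+ 2 / 32) ^+ n * (1 + d ^+ 2 / 32) ^+ n./2 <=
    4 * ((1 - th) ^+ n * (1 + d ^+ 2) ^+ n./2).
Proof.
move=> /andP[d0 d1] /andP[t0 t1]; set x := d ^+ 2 in t1 *; set h := n./2.
have x0 : 0 <= x by rewrite sqr_ge0.
have x1 : x <= 1 by rewrite expr_le1 // ltW.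
have nE (y : R) : y ^+ n = y ^+ odd n * (y ^+ 2) ^+ h.
  by rewrite -[in LHS](odd_double_half n) exprD -mul2n exprM.
have odd_le (y : R) : 0 <= y -> y ^+ odd n <= 1 + y.
  by case: (odd n); rewrite ?expr0 ?expr1; lra.
have odd_ge (y : R) : 0 <= y <= 1 -> y <= y ^+ odd n.
  by move=> ?; case: (odd n); rewrite ?expr0 ?expr1; lra.
set k := 1 + x / 32; set u := 1 - th.
have k0 : 0 <= k by rewrite /k; lra.
have u0 : 0 <= u by rewrite /u; lra.
have step : k ^+ 2 * k <= u ^+ 2 * (1 + x).
  have h1 : k ^+ 2 * k <= 1 + x / 2.
    pose y := x / 32; have y0 : 0 <= y by rewrite /y; lra.
    have y1 : y <= 1 by rewrite /y; lra.
    have y2 : y ^+ 2 <= y by rewrite expr2 -[leRHS]mulr1 ler_wpM2l.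
    have y3 : y ^+ 3 <= y by rewrite exprS -[leRHS]mulr1 ler_wpM2l // expr_le1.
    have -> : k ^+ 2 * k = 1 + 3 * y + 3 * y ^+ 2 + y ^+ 3 by rewrite /k -/y; ring.
    have -> : x = 32 * y by rewrite /y; field.
    lra.
  have h2 : 1 - x / 4 <= u ^+ 2.
    have -> : u ^+ 2 = 1 - 2 * th + th ^+ 2 by rewrite /u; ring.
    have := sqr_ge0 th; lra.
  have h3 : (1 - x / 4) * (1 + x) <= u ^+ 2 * (1 + x) by apply: ler_wpM2r => //; lra.
  have x2 : x ^+ 2 <= x by rewrite expr2 -[leRHS]mulr1 ler_wpM2l.
  have e : (1 - x / 4) * (1 + x) = 1 + 3 / 4 * x - x ^+ 2 / 4 by field.
  lra.
rewrite !nE -!mulrA.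
have -> : (k ^+ 2) ^+ h * k ^+ h = (k ^+ 2 * k) ^+ h by rewrite [RHS]exprMn.
have -> : (u ^+ 2) ^+ h * (1 + x) ^+ h = (u ^+ 2 * (1 + x)) ^+ h by rewrite [RHS]exprMn.
have q0 : 0 <= k ^+ 2 * k by rewrite mulr_ge0 ?exprn_ge0.
have hh : (k ^+ 2 * k) ^+ h <= (u ^+ 2 * (1 + x)) ^+ h.
  by apply: lerXn2r => //; rewrite nnegrE //; apply: le_trans step.
have p0 : 0 <= (k ^+ 2 * k) ^+ h by rewrite exprn_ge0.
rewrite mulrA; apply: ler_pM => //; first by rewrite exprn_ge0.
(* The constant 4 covers the unpaired factor when [n] is odd: [1 + k <= 4 u]. *)
have := odd_le k k0; have := odd_ge u; rewrite u0 /u /k => /(_ ltac:(lra)); lra.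
Qed.

Lemma exists_many_ham_cycles (p eps : R) r : 0 < p < 1 -> 0 < eps -> (3 <= r)%N ->
  exists2 kap, 0 < kap & exists N, forall n k, (N <= n)%N -> p * 'C(n, r)%:R = k%:R ->
  exists G : {set {set 'I_n}}, [/\ is_rgraph r G, #|G| = k,
    forall W : {set 'I_n}, #|W| = n./2 ->
      p - eps < (induced_edges G W)%:R / 'C(#|W|, r)%:R < p + eps &
    (1 + kap) ^+ n * (p ^+ n * n.-1`!%:R / 2) <= (Hcount r G)%:R].
Proof.
move=> p01 eps0 r3; have /andP[p0 p1] := p01; set Q := (4 ^ r)%:R : R.
have Q1 : 1 <= Q by rewrite ler1n expn_gt0.
have [|d [th [lam [[d0 dr1 dr2 dr3 d1] [th0 th1 th2] lamE]]]] :=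
  exists_parameters p eps Q r p01 eps0 Q1; first lia.
have th_small : th <= eps / 64.
  by apply: le_trans th2; rewrite -[leLHS]mulr1 ler_pM2l.
have d2_le1 : d ^+ 2 <= 1 by rewrite expr_le1 // ltW.
have d2_gt0 : 0 < d ^+ 2 by rewrite exprn_gt0.
have th_half : th <= 1 / 8 by lra.
have pth : p * th <= th by rewrite -[leRHS]mul1r ler_pM2r // ltW.
have pth0 : 0 < p * th by rewrite mulr_gt0.
have lam0 : 0 < lam by lra.
have lam1 : lam <= 1 / 64 by lra.
exists (d ^+ 2 / 32); first lra.
(* The 8 is the 4 of [gain_bound] times the net factor 2 between the two halvings in [A / 2] and the
   single one in the expected count. *)
have [|N1 HN1] := poly_le_exp (d ^+ 2 / 32) 8 r _ (ler0n _ _); first lra.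
pose b := 2048 / (p * lam ^+ 2).
have b0 : 0 <= b by rewrite divr_ge0 // mulr_ge0 ?sqr_ge0 // ltW.
exists (N1 + Num.bound b + 8 * r + 32)%N => n k nN pk.
have [nN1 nB nr] : [/\ (N1 <= n)%N, (Num.bound b <= n)%N & (8 * r + 32 <= n)%N].
  by move: nN; clear; move: (Num.bound b) => B ?; split; lia.
clear nN.
have nb : b <= n%:R.
  by apply: ltW; apply: lt_le_trans (archi_boundP b0) _; rewrite ler_nat.
have rn : (0 < r < n)%N by clear -r3 nr; lia.
(* [e0] bounds the Chernoff failure terms; even after a union bound over [2^n] sets it stays below
   [(p / 2)^n / 16], and [p / 2 <= c]. *)
pose e0 := (p / 64) ^+ n : R.
have e0_le : 2 ^+ n * e0 <= (p / 2) ^+ n / 16.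
  rewrite /e0 -exprMn (_ : 2 * (p / 64) = p / 2 * (1 / 16)); last by field.
  rewrite exprMn; apply: ler_wpM2l; first by rewrite exprn_ge0 // divr_ge0 // ltW.
  by rewrite -[X in _ <= X]mul1r; apply: ler_iXnr; clear -nr; [lia|lra|lra].
have p2 : (p / 2) ^+ n <= 1 by apply: exprn_ile1; clear -p0 p1; lra.
pose c := p * (1 - th).
have cE : c = p - p * th by rewrite /c; ring.
have c0 : 0 <= c by apply: mulr_ge0; [exact: ltW|clear -th_half; lra].
have cp : c <= p by rewrite cE gerBl ltW.
have c1 : c <= 1 by apply: le_trans cp (ltW p1).
have cp2 : p / 2 <= c.
  have : p * th <= p * (1 / 8) by rewrite ler_pM2l.
  rewrite cE; clear -p0; lra.
have t2n : 0 <= 2 ^+ n :> R by rewrite exprn_ge0.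
have E1 : expR (- (2 * lam ^+ 2 * 'C(n, r.-1)%:R)) <= e0.
  by apply: expR_beats => //; apply: sqr_le_bin; clear -r3 nr; lia.
have E2 : expR (- (2 * lam ^+ 2 * 'C(n./2, r)%:R)) <= e0.
  by apply: expR_beats => //; apply: sqr_le_bin; clear -r3 nr; lia.
have d0' := ltW d0.
have dr01 : d * r%:R <= 1 by clear -dr1; lra.
have lam01 : 0 < lam <= 1 / 2 by rewrite lam0 /=; clear -lam1; lra.
have small1 : 2 ^+ n * (2 * expR (- (2 * lam ^+ 2 * 'C(n, r.-1)%:R))) <= 1 / 2.
  have := ler_wpM2l t2n E1; clear -e0_le p2; lra.
have [w [wb wS wP]] := exists_good_weight n r d lam d0' dr01 rn lam01 small1.
pose A : R := c ^+ n * ((1 + d ^+ 2) ^+ n./2 / 2).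
have A0 : 0 < A.
  have cgt : 0 < c by apply: lt_le_trans cp2; clear -p0; lra.
  have D0 : 0 < 1 + d ^+ 2 by rewrite addr_gt0.
  by rewrite !mulr_gt0 ?exprn_gt0 ?invr_gt0.
pose pi e := c * w e.
have small2 : 2 ^+ n * (4 * expR (- (2 * lam ^+ 2 * 'C(n./2, r)%:R))) <= A / 2.
  have := ler_wpM2l t2n E2.
  have D1 : 1 <= (1 + d ^+ 2) ^+ n./2 by rewrite exprn_ege1 // lerDl ltW.
  have p20 : 0 <= p / 2 by clear -p0; lra.
  have u1 : (p / 2) ^+ n <= c ^+ n by apply: lerXn2r; rewrite ?nnegrE.
  have : (p / 2) ^+ n * 1 <= c ^+ n * (1 + d ^+ 2) ^+ n./2.
    by apply: ler_pM => //; rewrite exprn_ge0.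
  rewrite /A; clear -e0_le; lra.
have [G [G1 G2 G3 G4]] : exists G : {set {set 'I_n}}, [/\ is_rgraph r G, #|G| = k,
    forall W : {set 'I_n}, #|W| = n./2 ->
      p - eps < (induced_edges G W)%:R / 'C(#|W|, r)%:R < p + eps &
    A / 2 * n`!%:R <= #|[set s : {perm 'I_n} | ham_cycle r s \subset G]|%:R].
  (* [xi = 2 th] suffices: the shortfall is [p th 'C(n, r)] up to errors of order [lam 'C(n, r)],
     with [lam = p th / 8]. *)
  apply: (exists_quasi_random n r k p eps lam Q (2 * th) A pi) => //.
  - rewrite /Q -natrM ler_nat; apply: bin_half_le; clear -nr; lia.
  - clear -th2 eps0; lra.
  - clear -lamE pth th_small eps0; lra.
  - move=> e /wb; rewrite ler_norml => /andP[w1 w2]; rewrite /pi.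
    have w0 : 0 <= w e by clear -w1 dr1; lra.
    rewrite mulr_ge0 //=; have := ler_wpM2r w0 c1.
    have := ler_wpM2r w0 cp; have := ler_wpM2l (ltW p0) w2.
    have : p * (d * r%:R) <= 1 * (d * r%:R) by apply: ler_wpM2r; [rewrite mulr_ge0|exact: ltW].
    clear -dr2 p1; lra.
  - move=> e /wb; rewrite !ler_norml => /andP[w1 w2]; rewrite /pi.
    have := ler_wpM2l c0 w1; have := ler_wpM2l c0 w2.
    have : c * (d * r%:R) <= 1 * (d * r%:R) by apply: ler_wpM2r; [rewrite mulr_ge0|].
    clear -dr3 cE pth pth0 th_small; lra.
  - rewrite /= -big_distrr /=; move: wS; rewrite ler_norml.
    set S := \sum_(_ | _) _; set N := 'C(n, r)%:R => /andP[S1 S2].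
    have N0 : 0 <= N by [].
    have lN : 8 * lam * d * r%:R * N <= lam / 2 * N.
      apply: ler_wpM2r => //; have := ler_wpM2l (ltW lam0) dr1; clear; lra.
    have l1 : c * (lam / 2 * N) <= 1 * (lam / 2 * N).
      by apply: ler_wpM2r => //; rewrite mulr_ge0 // divr_ge0 // ltW.
    have sub : `|c * (S - N)| <= lam / 2 * N.
      rewrite normrM (ger0_norm c0) -[leRHS]mul1r; apply: le_trans l1.
      by apply: ler_wpM2l => //; rewrite ler_norml; clear -S1 S2 lN; apply/andP; split; lra.
    move: sub; rewrite ler_norml mulrBr {1 2}cE => /andP[].
    have tN : p * th * N <= th * N by apply: ler_wpM2r.
    have lE : lam * N = p * th * N / 8 by rewrite lamE; ring.
    have : 0 <= p * th * N by rewrite mulr_ge0 // ltW.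
    rewrite -cE; have -> : c * N = p * N - p * th * N by rewrite cE; ring.
    clear -tN lE => *; apply/andP; split; lra.
  - have q0 : 0 <= c ^+ n by rewrite exprn_ge0.
    have := ler_wpM2l q0 wP; rewrite mulrA => /le_trans; apply.
    rewrite big_distrr /=; apply: ler_sum => s _.
    by rewrite /pi big_split /= prodr_const card_ord.
exists G; split => //.
have n0 : (0 < n)%N by clear -nr; lia.
have cnt : A / 2 * n`!%:R <= (Hcount r G)%:R * n%:R ^+ r.
  by apply: le_trans G4 _; rewrite -natrX -natrM ler_nat card_perm_ham //; clear -r3 nr; lia.
have gain := gain_bound d th n (introT andP (conj d0 d1)) (introT andP (conj th0 th1)).
have HN := HN1 n nN1.
have nr0 : 0 < n%:R ^+ r :> R by rewrite exprn_gt0 // ltr0n.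
rewrite -(ler_pM2r nr0); apply: le_trans cnt.
have -> : n`!%:R = n%:R * n.-1`!%:R :> R by rewrite -natrM -{2 3}(prednK n0) -factS prednK.
set f := n.-1`!%:R; have f0 : 0 <= p ^+ n * f by rewrite mulr_ge0 // exprn_ge0 // ltW.
have n1 : 1 <= n%:R :> R by rewrite ler1n.
set K := (1 + d ^+ 2 / 32) ^+ n in gain *; set H := (1 + d ^+ 2 / 32) ^+ _ in gain HN.
have K0 : 0 <= K by rewrite exprn_ge0 // addr_ge0 // divr_ge0 // ltW.
have s1 := ler_wpM2l f0 (ler_wpM2l K0 HN).
have s2 := ler_wpM2l f0 gain.
have Af : A = p ^+ n * ((1 - th) ^+ n * (1 + d ^+ 2) ^+ n./2) / 2.
  by rewrite /A /c exprMn; ring.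
have s3 : A / 2 * (1 * f) <= A / 2 * (n%:R * f).
  by apply: ler_wpM2l; [rewrite divr_ge0 // ltW|apply: ler_wpM2r].
apply: le_trans s3; rewrite Af; clear -s1 s2; lra.
Qed.

End Main.

(* Transfer to the standard-library reals and conclusion *)
From mathcomp Require Import boolp Rstruct.

Lemma Rpower_ln_div (x : R) (n : nat) : Rlt 0 x ->
  Rpower 2 (Rmult (Rdiv (Rpower.ln x) (Rpower.ln 2)) (INR n)) = pow x n.
Proof.
move=> x0; rewrite -Rpower_mult -(Rpower_pow _ _ x0); congr Rpower.
rewrite /Rpower /Rdiv Rmult_assoc Rinv_l ?Rmult_1_r; first exact: Rpower.exp_ln.
by apply: Rgt_not_eq; rewrite -Rpower.ln_1; apply: Rpower.ln_increasing; [exact: Rlt_0_1|Lra.lra].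
Qed.

Theorem theorem2 (eps p : R) (r : nat) :
  Rlt 0 eps -> Rlt 0 p -> Rlt p 1 -> 3 <= r ->
  exists c : R, Rlt 0 c /\
  exists gamma : nat -> R,
    Un_cv gamma (if r == 3 then Rdiv 1 3 else Rdiv 1 2) /\
    exists N : nat, forall n : nat, N <= n ->
      (exists k : nat, Rmult p (INR 'C(n, r)) = INR k) ->
      Rle (Rpower 2 (Rmult c (Rpower (INR n) (gamma n))))
          (Rdiv (INR (Hmax r n p eps)) (Eexp n p)).
Proof.
move=> eps0 p0 p1 r3.
have p01 : (0 < p < 1)%R by apply/andP; split; apply/RltP.
have [kap /RltP kap0 [N HN]] := exists_many_ham_cycles p eps r p01 (introT RltP eps0) r3.
have ln2 : Rlt 0 (Rpower.ln 2).
  by rewrite -Rpower.ln_1; apply: Rpower.ln_increasing; [exact: Rlt_0_1|Lra.lra].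
have kap1 : Rlt 1 (Rplus 1 kap) by rewrite -{1}(Rplus_0_r 1); apply: Rplus_lt_compat_l.
(* This is the base-2 logarithm of [1 + kap], so that [2^(c n) = (1 + kap)^n]. *)
exists (Rdiv (Rpower.ln (Rplus 1 kap)) (Rpower.ln 2)); split.
  apply: Rdiv_lt_0_compat => //; rewrite -Rpower.ln_1.
  by apply: Rpower.ln_increasing => //; exact: Rlt_0_1.
set g := (if r == 3 then Rdiv 1 3 else Rdiv 1 2).
have g1 : Rle g 1 by rewrite /g; case: ifP => _; Lra.lra.
(* A constant exponent works: [n^g <= n] because [g <= 1] and [n >= 1], the latter ensured by the
   [maxn] below. *)
exists (fun=> g); split.
  by move=> e e0; exists 0 => n _; rewrite Rdist_eq.
exists (maxn 1 N) => n; rewrite geq_max => /andP[n1 nN] [k pk].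
have [|G [G1 G2 G3 G4]] := HN n k nN; first by rewrite -!INRE.
have qr : quasi_random r eps p G.
  split => //; split; first by rewrite G2.
  by move=> W /G3 /andP[/RltP h1 /RltP h2]; rewrite !INRE.
have HG : Hcount r G <= Hmax r n p eps.
  by apply: (leq_bigmax_cond (F := fun G => Hcount r G)); apply/asboolP.
have E0 : Rlt 0 (Eexp n p).
  rewrite /Eexp; apply: Rdiv_lt_0_compat; last Lra.lra.
  apply: Rmult_lt_0_compat; first exact: pow_lt.
  by apply: lt_0_INR; apply/ltP; exact: fact_gt0.
have nR : Rle 1 (INR n) by apply: (le_INR 1); apply/leP.
apply: (Rle_trans _ (pow (Rplus 1 kap) n)).
  rewrite -Rpower_ln_div; last by Lra.lra.
  apply: Rle_Rpower; first Lra.lra.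
  apply: Rmult_le_compat_l.
    apply: Rlt_le; apply: Rdiv_lt_0_compat => //; rewrite -Rpower.ln_1.
    by apply: Rpower.ln_increasing => //; exact: Rlt_0_1.
  rewrite -{2}(Rpower_1 (INR n)); last Lra.lra.
  exact: Rle_Rpower.
apply: (Rmult_le_reg_r (Eexp n p)) => //.
rewrite /Rdiv Rmult_assoc Rinv_l ?Rmult_1_r; last exact: Rgt_not_eq.
apply: (Rle_trans _ (INR (Hcount r G))); last by apply: le_INR; apply/leP.
by move/RleP: G4; rewrite /Eexp !RealsE.
Qed.
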